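(* Let $(H,\circ)$ be a hypersemigroup. The following are equivalent: (1) $H$ is simple. (2) $H=H*\{a\}*H$ for every $a\in H$. (3) $H$ is fuzzy simple. (4) Every fuzzy interior ideal of $H$ is a constant function.
   Context: A hypergroupoid is a nonempty set $H$ with a map $\circ: H\times H\to \mathcal{P}^*(H)$, where $\mathcal{P}^*(H)$ is the set of nonempty subsets of $H$. For $A,B\in\mathcal{P}^*(H)$ put $A*B=\bigcup_{(a,b)\in A\times B}(a\circ b)$; thus $\{x\}*\{y\}=x\circ y$. A hypersemigroup is a hypergroupoid with $\{x\}*(y\circ z)=(x\circ y)*\{z\}$ for all $x,y,z\in H$; then $*$ is associative on $\mathcal{P}^*(H)$, so $A*B*C$ is unambiguous. A nonempty subset $A$ of $H$ is an ideal of $H$ if $H*A\subseteq A$ and $A*H\subseteq A$. $H$ is simple if every ideal $A$ of $H$ satisfies $A=H$. A fuzzy subset of $H$ is a map $f:H\to[0,1]$ (real interval). It is a fuzzy left ideal if for all $x,y\in H$ and all $u\in x\circ y$, $f(u)\ge f(y)$; a fuzzy right ideal if for all $x,y\in H$ and all $u\in x\circ y$, $f(u)\ge f(x)$; a fuzzy ideal if it is both a fuzzy left ideal and a fuzzy right ideal. It is a fuzzy interior ideal if for all $x,a,y\in H$ and all $u\in (x\circ a)*\{y\}$, $f(u)\ge f(a)$. $H$ is fuzzy simple if every fuzzy ideal of $H$ is a constant function. *)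

(* Defs.v *)
From mathcomp Require Import all_boot all_order all_algebra.
From mathcomp Require Import boolp classical_sets reals interval_inference.

Set Implicit Arguments.
Unset Strict Implicit.
Unset Printing Implicit Defensive.

Local Open Scope classical_set_scope.
Local Open Scope ring_scope.

Record hypergroupoid := Hypergroupoid {
  carrier :> Type;
  hop : carrier -> carrier -> set carrier;
  carrier_neq0 : [set: carrier] !=set0;
  hop_neq0 : forall x y : carrier, hop x y !=set0
}.

Declare Scope hyper_scope.
Delimit Scope hyper_scope with hyper.
Notation "x \o' y" := (hop x y) (at level 40, left associativity) : hyper_scope.

Section Hyper.
Variable H : hypergroupoid.
Local Open Scope hyper_scope.

(* Defined on all subsets of H; it maps nonempty subsets to a nonempty subset. *)
Definition hmul (A B : set H) : set H :=
  \bigcup_(p in A `*` B) (p.1 \o' p.2).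

Local Notation "A ** B" := (hmul A B) (at level 40, left associativity).

Definition hypersemigroup : Prop :=
  forall x y z : H, [set x] ** (y \o' z) = (x \o' y) ** [set z].

Definition hideal (A : set H) : Prop :=
  [/\ A !=set0, [set: H] ** A `<=` A & A ** [set: H] `<=` A].

Definition hsimple : Prop := forall A : set H, hideal A -> A = [set: H].

End Hyper.

Notation "A ** B" := (hmul A B) (at level 40, left associativity) : hyper_scope.

Section Fuzzy.
Variables (R : realType) (H : hypergroupoid).
Local Open Scope hyper_scope.

(* {i01 R} is the type of the elements of the real interval [0, 1]. *)
Definition fuzzy_subset : Type := H -> {i01 R}.

Implicit Type f : fuzzy_subset.

Definition fuzzy_left_ideal f : Prop :=
  forall x y u : H, (x \o' y) u -> (f y)%:num <= (f u)%:num.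

Definition fuzzy_right_ideal f : Prop :=
  forall x y u : H, (x \o' y) u -> (f x)%:num <= (f u)%:num.

Definition fuzzy_ideal f : Prop := fuzzy_left_ideal f /\ fuzzy_right_ideal f.

Definition fuzzy_interior_ideal f : Prop :=
  forall x a y u : H, ((x \o' a) ** [set y]) u -> (f a)%:num <= (f u)%:num.

Definition constant_fuzzy f : Prop := exists c : {i01 R}, forall x : H, f x = c.

Definition fuzzy_simple : Prop := forall f, fuzzy_ideal f -> constant_fuzzy f.

End Fuzzy.

(* Main.v *)
Require Import Defs.
From mathcomp Require Import all_boot all_order all_algebra.
From mathcomp Require Import boolp classical_sets reals interval_inference.

(** The bridge between ideals and fuzzy ideals is the characteristic function:
    that of an ideal is a fuzzy ideal ([fuzzy_ideal_indicator]), and it is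
    constant only if the ideal is all of [H]; hence fuzzy simplicity implies
    simplicity.  In a simple hypersemigroup the ideal [H * {a} * H] is all of
    [H] ([hideal_principal]).  Then every [b] lies in [(x o a) * {y}] for some
    [x] and [y], so a fuzzy interior ideal satisfies [f a <= f b]; exchanging
    [a] and [b] makes [f] constant ([fuzzy_interior_constant]).  Finally every
    fuzzy ideal is a fuzzy interior ideal ([fuzzy_ideal_interior]), so
    constancy of the latter gives fuzzy simplicity.  A fuzzy interior ideal
    need not be a fuzzy ideal, so the way from fuzzy simplicity to constancy of
    fuzzy interior ideals goes through the equality [H = H * {a} * H]. *)

Local Open Scope classical_set_scope.
Local Open Scope ring_scope.
Local Open Scope hyper_scope.

Import Order.TTheory GRing.Theory Num.Theory.

Section HyperProduct.
Context {H : hypergroupoid}.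
Implicit Types A B C D : set H.

Lemma hmulP A B u :
  (A ** B) u <-> exists a b, [/\ A a, B b & (a \o' b) u].
Proof.
split=> [[[a b] [/= Aa Bb] abu]|[a [b [Aa Bb abu]]]]; first by exists a, b.
by exists (a, b).
Qed.

Lemma hmulS A B C D : A `<=` C -> B `<=` D -> A ** B `<=` C ** D.
Proof.
move=> AC BD u /hmulP[a [b [Aa Bb abu]]]; apply/hmulP.
by exists a, b; split=> //; [exact: AC | exact: BD].
Qed.

Lemma hmul_neq0 A B : A !=set0 -> B !=set0 -> A ** B !=set0.
Proof.
move=> [a Aa] [b Bb]; have [u abu] := hop_neq0 a b.
by exists u; apply/hmulP; exists a, b.
Qed.

Lemma hmulA (hH : hypersemigroup H) A B C : A ** (B ** C) = A ** B ** C.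
Proof.
apply/seteqP; split=> u /hmulP[p [q []]].
- move=> Ap /hmulP[b [c [Bb Cc bcq]]] pqu.
  have : ([set p] ** (b \o' c)) u by apply/hmulP; exists p, q.
  rewrite hH => /hmulP[d [_ [pbd -> dcu]]].
  by apply/hmulP; exists d, c; split=> //; apply/hmulP; exists p, b.
- move=> /hmulP[a [b [Aa Bb abp]]] Cq pqu.
  have : ((a \o' b) ** [set q]) u by apply/hmulP; exists p, q.
  rewrite -hH => /hmulP[_ [d [-> bqd adu]]].
  by apply/hmulP; exists a, d; split=> //; apply/hmulP; exists b, q.
Qed.

(** Associativity lets the factor [H] absorb a further factor [H] multiplied
    on its side. *)
Lemma hideal_principal (hH : hypersemigroup H) (a : H) :
  hideal ([set: H] ** [set a] ** [set: H]).
Proof.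
have H0 := carrier_neq0 H.
split.
- by do 2![apply: hmul_neq0 => //]; exists a.
- by rewrite !(hmulA hH); do 2![apply: hmulS => //].
- by rewrite -[X in X `<=` _](hmulA hH); apply: hmulS.
Qed.

End HyperProduct.

Section FuzzyIdeals.
Context {R : realType} {H : hypergroupoid}.
Implicit Types (A : set H) (f : fuzzy_subset R H).

Definition fuzzy_indicator A : fuzzy_subset R H :=
  fun x => if `[< A x >] then 1%:i01 else 0%:i01.

Lemma fuzzy_indicator_le A x y : (A x -> A y) ->
  (fuzzy_indicator A x)%:num <= (fuzzy_indicator A y)%:num.
Proof.
rewrite /fuzzy_indicator => Axy.
case: (asboolP (A x)) => Ax; case: (asboolP (A y)) => //= Ay.
by case: Ay; exact: Axy.
Qed.

Lemma fuzzy_ideal_indicator A : hideal A -> fuzzy_ideal (fuzzy_indicator A).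
Proof.
move=> [_ HA AH]; split=> x y u xyu; apply: fuzzy_indicator_le => Axy.
- by apply: HA; apply/hmulP; exists x, y.
- by apply: AH; apply/hmulP; exists x, y.
Qed.

Lemma constant_fuzzy_indicator A :
  A !=set0 -> constant_fuzzy (fuzzy_indicator A) -> A = [set: H].
Proof.
move=> [a Aa] [c fc]; apply/seteqP; split=> // x _.
apply: contrapT => nAx.
have := congr1 (fun t : {i01 R} => t%:num) (etrans (fc a) (esym (fc x))).
by rewrite /fuzzy_indicator asboolT // asboolF //= => /eqP; rewrite oner_eq0.
Qed.

Lemma fuzzy_simple_hsimple : fuzzy_simple R H -> hsimple H.
Proof.
move=> fH A iA; have [A0 _ _] := iA.
by apply: constant_fuzzy_indicator => //; apply: fH; exact: fuzzy_ideal_indicator.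
Qed.

Lemma fuzzy_ideal_interior f : fuzzy_ideal f -> fuzzy_interior_ideal f.
Proof.
move=> [fl fr] x a y u /hmulP[c [_ [xac -> cyu]]].
exact: le_trans (fl _ _ _ xac) (fr _ _ _ cyu).
Qed.

Lemma fuzzy_interior_constant f :
  (forall a : H, [set: H] = [set: H] ** [set a] ** [set: H]) ->
  fuzzy_interior_ideal f -> constant_fuzzy f.
Proof.
move=> HaH fi.
have f_le a b : (f a)%:num <= (f b)%:num.
  have : [set: H] b by [].
  rewrite (HaH a) => /hmulP[c [y [/hmulP[x [_ [_ -> xac]]] _ cyb]]].
  by apply: (fi x a y b); apply/hmulP; exists c, y.
have [x0 _] := carrier_neq0 H; exists (f x0) => x.
by apply/val_inj/le_anti; rewrite !f_le.
Qed.

End FuzzyIdeals.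

Theorem theorem2p25 (R : realType) (H : hypergroupoid)
    (hH : hypersemigroup H) :
  [<-> hsimple H;
       forall a : H, [set: H] = [set: H] ** [set a] ** [set: H];
       fuzzy_simple R H;
       forall f : fuzzy_subset R H, fuzzy_interior_ideal f -> constant_fuzzy f].
Proof.
have principal : hsimple H ->
    forall a : H, [set: H] = [set: H] ** [set a] ** [set: H].
  by move=> sH a; rewrite (sH _ (hideal_principal hH a)).
tfae.
- exact: principal.
- by move=> HaH f /fuzzy_ideal_interior; exact: fuzzy_interior_constant.
- move=> /fuzzy_simple_hsimple/principal HaH f; exact: fuzzy_interior_constant.
- move=> cH; apply: (@fuzzy_simple_hsimple R) => f /fuzzy_ideal_interior.
  exact: cH.
Qed.
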